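(* Let $\mathcal{G}$ be a nonempty signed colored graph of type $(n,n)$ satisfying Axiom 1 and admitting a morphism $\phi\colon\mathcal{G}\to\mathcal{G}_\lambda$ for some $\lambda\vdash n$. Then $\mathcal{G}$ is isomorphic to the $(n,n)$-restriction of some signed colored graph $\mathcal{H}=(V',\sigma',E'_2\cup\dots\cup E'_{n-1})$ with $\sigma'\colon V'\to\{\pm1\}^{N-1}$ for some $N\ge n$, satisfying: (1) $\mathcal{H}$ obeys Axiom 1; (2) $V'\subseteq S_N$; (3) $\sigma'(v')$ is the signature (given by inverse descents) of the permutation $v'$; (4) for all $1<i<n$ and all $v'\in V'$ admitting an $i$-edge, $E'_i(v')$ is Knuth equivalent to $d_i(v')$.
   Context: Tableaux are in French notation. $P(w)$ is the Robinson–Schensted insertion tableau of a permutation $w$; permutations are Knuth equivalent if they have the same insertion tableau. For $w\in S_N$, $\sigma(w)\in\{\pm1\}^{N-1}$ with $\sigma(w)_i=+1$ if $i$ appears before $i+1$ in $w$, $-1$ otherwise; a tableau's signature is that of its row reading word (rows left to right, starting with the top row). For $1<i<N$, $d_i$ fixes $w$ if the value $i$ lies positionally between $i-1$ and $i+1$; otherwise it interchanges $i$ with whichever of $i-1,i+1$ is not in the middle of the three positions; it acts on tableaux via row reading words. For $\lambda\vdash n$, $\mathcal G_\lambda$ has vertex set $\mathrm{SYT}(\lambda)$, tableau signatures, and $i$-edges $\{T,d_i(T)\}$ with $d_i(T)\ne T$, $1<i<n$. A signed colored graph $(V,\sigma,E_{m+1}\cup\dots\cup E_{n-1})$ has a finite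 vertex set $V$, sets $E_i$ ($m<i<n$) of unordered pairs of distinct vertices, and $\sigma\colon V\to\{\pm1\}^{N-1}$ with $N\ge n$; it has type $(n,N)$ if $m=1$. Its $(m',M)$-restriction discards $E_i$ for $i\ge m'$ and truncates signatures to their first $M-1$ coordinates. A morphism sends $i$-edges to $i$-edges and preserves signatures; an isomorphism is a morphism with an inverse morphism. A vertex $v$ admits an $i$-neighbor if $\sigma(v)_{i-1}=-\sigma(v)_i$. Axiom 1: each $E_i$ is a complete matching on the vertices admitting an $i$-neighbor; $E_i(v)$ then denotes the vertex matched with $v$. *)

(* Defs.v *)
From HB Require Import structures.
From mathcomp Require Import all_boot all_fingroup.

Set Implicit Arguments.
Unset Strict Implicit.
Unset Printing Implicit Defensive.

(* One-line notation with values in 1..N; library permutations act on 0..N-1. *)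
Definition oneline N (w : {perm 'I_N}) : seq nat :=
  [seq (val (w j)).+1 | j <- enum 'I_N].

(* Tableaux are lists of rows in French notation: the first row of the list is
   the bottom one. *)
Notation tableau := (seq (seq nat)).

Definition reading_word (T : tableau) : seq nat := flatten (rev T).

Fixpoint row_insert (x : nat) (T : tableau) : tableau :=
  if T is r :: T' then
    let k := find (fun y => x < y) r in
    if k < size r then set_nth 0 r k x :: row_insert (nth 0 r k) T'
    else rcons r x :: T'
  else [:: [:: x]].

Definition insertion_tableau (w : seq nat) : tableau :=
  foldl (fun T x => row_insert x T) [::] w.

Definition knuth_equiv (u w : seq nat) : Prop :=
  insertion_tableau u = insertion_tableau w.

(* Signs are booleans: [true] is +1 and [false] is -1. *)
Definition signature (w : seq nat) : seq bool :=
  [seq index i w < index i.+1 w | i <- iota 1 (size w).-1].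

(* Coordinates of signatures are numbered from 1. *)
Definition coord (s : seq bool) (i : nat) : bool := nth false s i.-1.

Definition swap_values (x y : nat) (w : seq nat) : seq nat :=
  [seq (if z == x then y else if z == y then x else z) | z <- w].

Definition between (p q r : nat) : bool := (p < q < r) || (r < q < p).

(* The map d_i on words containing i-1, i, i+1 once each. *)
Definition dual_move (i : nat) (w : seq nat) : seq nat :=
  let a := index i.-1 w in let b := index i w in let c := index i.+1 w in
  if between a b c then w
  else if between b a c then swap_values i i.+1 w
  else swap_values i i.-1 w.

Definition is_partition_of (n : nat) (lam : seq nat) : bool :=
  [&& sorted geq lam, 0 \notin lam & sumn lam == n].

Definition col_increasing (r r' : seq nat) : bool :=
  all (fun j => nth 0 r j < nth 0 r' j) (iota 0 (size r')).

Definition is_syt (n : nat) (lam : seq nat) (T : tableau) : bool :=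
  [&& shape T == lam, perm_eq (flatten T) (iota 1 n),
      all (sorted ltn) T & sorted col_increasing T].

Record syt (n : nat) (lam : seq nat) :=
  Syt { rows :> tableau; rowsP : is_syt n lam rows }.

HB.instance Definition _ n lam := [isSub for @rows n lam].
HB.instance Definition _ n lam := [Countable of syt n lam by <:].

Section SytFinite.
Variables (n : nat) (lam : seq nat).

Let encode (T : syt n lam) : {ffun 'I_n -> 'I_n.+1} :=
  [ffun j : 'I_n => inord (nth 0 (flatten T) j)].
Let decode (t : {ffun 'I_n -> 'I_n.+1}) : option (syt n lam) :=
  insub (reshape lam [seq val (t j) | j <- enum 'I_n]).

Lemma syt_encodeK : pcancel encode decode.
Proof.
move=> T; rewrite /decode; case/and4P: (rowsP T) => /eqP shT pT _ _.
have szT : size (flatten T) = n by rewrite (perm_size pT) size_iota.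
have -> : [seq val (encode T j) | j <- enum 'I_n] = flatten T.
  apply: (@eq_from_nth _ 0); first by rewrite size_map size_enum_ord.
  move=> i; rewrite size_map size_enum_ord => lt_i_n.
  rewrite (nth_map (Ordinal lt_i_n)) ?size_enum_ord // ffunE nth_enum_ord //.
  apply: inordK.
  have: nth 0 (flatten T) i \in iota 1 n.
    by rewrite -(perm_mem pT) mem_nth ?szT.
  by rewrite mem_iota => /andP[].
have -> : reshape lam (flatten T) = T by have := flattenK T; rewrite shT.
exact: (valK T).
Qed.

HB.instance Definition _ := isFinite.Build (syt n lam) (pcan_enumP syt_encodeK).
End SytFinite.

(* [edges i] is the set E_i of unordered pairs; it is empty for i outside the
   range 1 < i < n. *)
Record scgraph (n N : nat) (V : finType) := SCGraph {
  sig : V -> seq bool;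
  edges : nat -> {set {set V}};
  type_leq : n <= N;
  size_sig : forall v, size (sig v) = N.-1;
  edges_range : forall i e, e \in edges i -> 1 < i < n;
  edges_pair : forall i e, e \in edges i -> #|e| = 2
}.

Section Graphs.
Variables (n N : nat) (V : finType) (G : scgraph n N V).

Definition admits_neighbor (i : nat) (v : V) : bool :=
  coord (sig G v) i.-1 == ~~ coord (sig G v) i.

(* As elements of [edges G i] are pairs, this says that E_i is a complete
   matching on the vertices admitting an i-neighbor. *)
Definition axiom1 : Prop :=
  forall i, 1 < i < n ->
    partition (edges G i) [set v | admits_neighbor i v].

(* E_i(v); the default value v is irrelevant when v is matched by E_i. *)
Definition neighbor (i : nat) (v : V) : V :=
  odflt v [pick u | [set v; u] \in edges G i].

Section Restriction.
Variables (m M : nat) (le_mM : m <= M) (le_MN : M <= N).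

Let sig_restr v := take M.-1 (sig G v).
Let edges_restr i := if i < m then edges G i else set0.

Fact restr_size_sig v : size (sig_restr v) = M.-1.
Proof.
by rewrite size_take_min size_sig; apply/minn_idPl; rewrite -!subn1 leq_sub2r.
Qed.

Fact restr_edges_range i e : e \in edges_restr i -> 1 < i < m.
Proof.
rewrite /edges_restr; case: ifP => [lt_im|]; last by rewrite inE.
by move/edges_range/andP=> [-> _].
Qed.

Fact restr_edges_pair i e : e \in edges_restr i -> #|e| = 2.
Proof.
rewrite /edges_restr; case: ifP => [_|]; last by rewrite inE.
exact: edges_pair.
Qed.

Definition restriction : scgraph m M V :=
  SCGraph le_mM restr_size_sig restr_edges_range restr_edges_pair.

End Restriction.
End Graphs.

Definition scg_morphism n N (V W : finType) (G : scgraph n N V)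
    (H : scgraph n N W) (f : V -> W) : Prop :=
  (forall v, sig H (f v) = sig G v) /\
  (forall i e, e \in edges G i -> [set f x | x in e] \in edges H i).

Definition isomorphic n N (V W : finType) (G : scgraph n N V)
    (H : scgraph n N W) : Prop :=
  exists (f : V -> W) (g : W -> V),
    [/\ scg_morphism G H f, scg_morphism H G g, cancel f g & cancel g f].

Section StandardGraph.
Variables (n : nat) (lam : seq nat).

Let sig_syt (T : syt n lam) := signature (reading_word T).

(* Tableaux of a given shape are determined by their reading words. *)
Let edges_syt i : {set {set syt n lam}} :=
  if 1 < i < n then
    [set e : {set syt n lam} |
       [exists T : syt n lam, exists U : syt n lam,
          [&& U != T, reading_word U == dual_move i (reading_word T)
            & e == [set T; U]]]]
  else set0.

Fact syt_size_sig T : size (sig_syt T) = n.-1.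
Proof.
case/and4P: (rowsP T) => _ pT _ _.
rewrite size_map size_iota /reading_word; congr _.-1.
have -> : size (flatten (rev T)) = size (flatten T).
  by rewrite !size_flatten /shape map_rev sumn_rev.
by rewrite (perm_size pT) size_iota.
Qed.

Fact syt_edges_range i e : e \in edges_syt i -> 1 < i < n.
Proof. by rewrite /edges_syt; case: ifP => // _; rewrite inE. Qed.

Fact syt_edges_pair i e : e \in edges_syt i -> #|e| = 2.
Proof.
rewrite /edges_syt; case: ifP => [_|]; last by rewrite inE.
rewrite inE => /existsP[T /existsP[U /and3P[neqUT _ /eqP->]]].
by rewrite cards2 eq_sym neqUT.
Qed.

Definition syt_graph : scgraph n n (syt n lam) :=
  SCGraph (leqnn n) syt_size_sig syt_edges_range syt_edges_pair.

End StandardGraph.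

(* Main.v *)
(* A vertex v is sent to the permutation whose word is the reading word of
   phi(v) followed by a word u_k in the letters n+1, n+2, ...  Here
   u_k = n+2 ... n+2+k, n+1, n+3+k ..., where k is the rank of v in an
   enumeration of V.  The suffix u_k separates the vertices, while inserting it
   into a tableau with entries at most n gives a result independent of k.  As
   d_i only rearranges the letters up to n, and phi maps an i-edge of v to
   {phi(v), d_i(phi(v))}, the words of E_i(v) and of d_i(v) differ only in their
   suffixes, hence are Knuth equivalent. *)
Require Import Defs.
From mathcomp Require Import all_boot all_fingroup.
From mathcomp Require Import zify.

Set Implicit Arguments.
Unset Strict Implicit.
Unset Printing Implicit Defensive.

(** * Row insertion of the suffix words u_k *)

Lemma row_insert_all (P : pred nat) x T :
  P x -> all (all P) T -> all (all P) (row_insert x T).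
Proof.
elim: T x => [|r T IHT] x Px /=; first by rewrite Px.
case/andP=> Pr PT; case: ifP => [lt_k|_] /=; last by rewrite all_rcons Px Pr.
rewrite (IHT _ _ PT) ?andbT; last by rewrite (allP Pr) ?mem_nth.
apply/allP=> y /(nthP 0)[j]; rewrite size_set_nth (maxn_idPr lt_k) => lt_j <-.
by rewrite nth_set_nth /=; case: eqP => // _; rewrite (allP Pr) ?mem_nth.
Qed.

Lemma insertion_tableau_all (P : pred nat) w :
  all P w -> all (all P) (insertion_tableau w).
Proof.
rewrite /insertion_tableau.
have: all (all P) [::] by [].
elim: w [::] => //= x w IHw T PT /andP[Px Pw].
by apply: IHw => //; apply: row_insert_all.
Qed.

Lemma row_insert_max x r T :
  all (geq x) r -> row_insert x (r :: T) = rcons r x :: T.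
Proof.
move=> le_rx /=; have -> : find (fun y => x < y) r = size r.
  apply/hasNfind/hasPn=> y /(allP le_rx) /=; lia.
by rewrite ltnn.
Qed.

Lemma insert_iota m l r T : all (geq m) r ->
  foldl (fun T x => row_insert x T) (r :: T) (iota m l) = (r ++ iota m l) :: T.
Proof.
elim: l m r => [|l IHl] m r le_rm; first by rewrite cats0.
rewrite [iota _ _]/= [foldl _ _ _]/= -/(row_insert m (r :: T)).
rewrite row_insert_max // IHl ?cat_rcons //.
rewrite all_rcons /= leqnSn; apply: sub_all le_rm => y /=; lia.
Qed.

(** The word u_k on the letters n+1, ..., n+K+1. Taking [k.+1] letters first puts n+2 before n+1 for
    every k < K, so n+1 always has a letter to bump. *)
Definition tail_word (n K k : nat) : seq nat :=
  take k.+1 (iota n.+2 K) ++ n.+1 :: drop k.+1 (iota n.+2 K).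

(* The letter n+1 bumps n+2 out of the bottom row, whatever precedes it. *)
Lemma insert_tail_word n K k T : k < K -> all (all (geq n)) T ->
  foldl (fun T x => row_insert x T) T (tail_word n K k) =
  (head [::] T ++ n.+1 :: iota n.+3 K.-1) :: row_insert n.+2 (behead T).
Proof.
move=> lt_kK le_Tn.
(* The suffix is nonempty, so the empty tableau may be replaced by a single empty row: the first
   insertion gives the same result. *)
have -> : foldl (fun T x => row_insert x T) T (tail_word n K k) =
    foldl (fun T x => row_insert x T) (head [::] T :: behead T)
      (tail_word n K k).
  by case: T {le_Tn} => //; rewrite /tail_word; case: K lt_kK.
have le_rn : all (geq n) (head [::] T) by case: T le_Tn => //= r T /andP[].
move: (head _ _) le_rn => r le_rn.
rewrite /tail_word foldl_cat take_iota drop_iota (minn_idPl lt_kK).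
rewrite insert_iota; last by apply: sub_all le_rn => y /=; lia.
(* No entry of [r] exceeds n+1, so n+1 bumps the entry just after [r], which is n+2. *)
have find_r : find (fun y => n.+1 < y) r = size r.
  apply/hasNfind/hasPn=> y /(allP le_rn) /=; lia.
rewrite /= find_cat has_find find_r ltnn /= ltnSn addn0 size_cat /= -addSnnS.
rewrite leq_addr nth_cat ltnn subnn /=.
have -> : set_nth 0 (r ++ n.+2 :: iota n.+3 k) (size r) n.+1 =
    r ++ n.+1 :: iota n.+3 k.
  by elim: (r) => //= y s ->.
rewrite insert_iota -?catA ?cat_cons.
  congr ((_ ++ _ :: _) :: _).
  rewrite (_ : K.-1 = k + (K - k.+1)); last lia.
  by rewrite iotaD; congr (_ ++ iota _ _); lia.
rewrite all_cat /=; apply/and3P; split; last 1 first.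
- by apply/allP=> y; rewrite mem_iota /=; lia.
- by apply: sub_all le_rn => y /=; lia.
- lia.
Qed.

(** The tableau found in [insert_tail_word] does not involve k. *)
Lemma knuth_equiv_tail_word n K j k w : all (geq n) w -> j < K -> k < K ->
  knuth_equiv (w ++ tail_word n K j) (w ++ tail_word n K k).
Proof.
move=> /insertion_tableau_all le_n lt_j lt_k.
rewrite /knuth_equiv /insertion_tableau !(foldl_cat _ _ w).
by rewrite (insert_tail_word lt_j le_n) (insert_tail_word lt_k le_n).
Qed.

Lemma tail_word_perm n K k : perm_eq (tail_word n K k) (iota n.+1 K.+1).
Proof. by rewrite perm_catC /= perm_cons perm_catC cat_take_drop. Qed.

(** The position of n+1 recovers k; this is what separates the vertices. *)
Lemma index_tail_word n K k : k < K -> index n.+1 (tail_word n K k) = k.+1.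
Proof.
move=> lt_kK; rewrite /tail_word index_cat take_iota mem_iota (minn_idPl lt_kK).
by rewrite ltnn /= eqxx addn0 size_iota.
Qed.

(** * The involution d_i on words *)

Lemma swap_values_cat x y u w :
  swap_values x y (u ++ w) = swap_values x y u ++ swap_values x y w.
Proof. exact: map_cat. Qed.

Lemma swap_values_id x y w :
  x \notin w -> y \notin w -> swap_values x y w = w.
Proof.
move=> xNw yNw; rewrite -[RHS]map_id; apply/eq_in_map => z w_z.
case: eqP => [zx|_]; first by rewrite -zx w_z in xNw.
by case: eqP => // zy; rewrite -zy w_z in yNw.
Qed.

Lemma swap_valuesK x y : involutive (swap_values x y).
Proof.
move=> w; rewrite /swap_values -map_comp -[RHS]map_id; apply: eq_map => z /=.
by do ![case: eqP => //=] => *; congruence.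
Qed.

(** The renaming of letters is injective, so a renamed letter stands where the original stood. *)
Lemma index_swap_values x y z w :
  index (if z == x then y else if z == y then x else z) (swap_values x y w) =
  index z w.
Proof.
rewrite (index_map (f := fun z => if z == x then y else if z == y then x else z)) //.
by move=> a b; do ![case: eqP => //=] => *; congruence.
Qed.

(** The positions compared by d_i all lie in [u], and the letters it exchanges are absent from
    [w]. *)
Lemma dual_move_cat i u w :
    {in [:: i.-1; i; i.+1], forall x, (x \in u) && (x \notin w)} ->
  dual_move i (u ++ w) = dual_move i u ++ w.
Proof.
move=> uNw.
have /andP[u1 w1] : (i.-1 \in u) && (i.-1 \notin w) by apply: uNw; rewrite !inE eqxx.
have /andP[u2 w2] : (i \in u) && (i \notin w) by apply: uNw; rewrite !inE eqxx orbT.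
have /andP[u3 w3] : (i.+1 \in u) && (i.+1 \notin w)
  by apply: uNw; rewrite !inE eqxx !orbT.
rewrite /dual_move !index_cat u1 u2 u3 !swap_values_cat.
by do 2![case: ifP => // _]; rewrite [swap_values _ _ w]swap_values_id.
Qed.

(** A swap exchanges the two outer letters and leaves the middle one in place, so the second
    application makes the same swap. *)
Lemma dual_moveK i w : 0 < i -> {subset [:: i.-1; i; i.+1] <= w} ->
  dual_move i (dual_move i w) = w.
Proof.
move=> i_gt0 sub_w.
have w1 : i.-1 \in w by apply: sub_w; rewrite !inE eqxx.
have w2 : i \in w by apply: sub_w; rewrite !inE eqxx orbT.
have w3 : i.+1 \in w by apply: sub_w; rewrite !inE eqxx !orbT.
have neq_index x y : x \in w -> y \in w -> x <> y -> index x w <> index y w.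
  move=> w_x w_y neq_xy /(congr1 (nth 0 w)); rewrite !nth_index //.
have n12 : index i.-1 w <> index i w by apply: neq_index => //; lia.
have n13 : index i.-1 w <> index i.+1 w by apply: neq_index => //; lia.
have n23 : index i w <> index i.+1 w by apply: neq_index => //; lia.
rewrite {2}/dual_move; case: ifP => [b_mid|bN]; first by rewrite /dual_move b_mid.
case: ifP => [a_mid|aN].
  have /= := index_swap_values i i.+1 i.-1 w.
  have /= := index_swap_values i i.+1 i w.
  have /= := index_swap_values i i.+1 i.+1 w.
  rewrite !eqxx !(ifF _ _ (_ : (_ == _) = false)); try lia.
  move=> e3 e2 e1; rewrite /dual_move e1 e2 e3.
  by rewrite ifF 1?ifT ?swap_valuesK //; move: a_mid; rewrite /between; lia.
(* Here i+1 is in the middle; swapping i and i-1 makes [aN] and [bN] trade roles. *)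
have /= := index_swap_values i i.-1 i.-1 w.
have /= := index_swap_values i i.-1 i w.
have /= := index_swap_values i i.-1 i.+1 w.
rewrite !eqxx !(ifF _ _ (_ : (_ == _) = false)); try lia.
move=> e3 e2 e1; rewrite /dual_move e1 e2 e3.
by rewrite !ifF ?swap_valuesK //; move: aN bN; rewrite /between; lia.
Qed.

(** * Permutations in one-line notation and signatures of words *)

Lemma oneline_surj N w :
  perm_eq w (iota 1 N.+1) -> exists p : {perm 'I_N.+1}, oneline p = w.
Proof.
move=> pw; have szw : size w = N.+1 by rewrite (perm_size pw) size_iota.
have uw : uniq w by rewrite (perm_uniq pw) iota_uniq.
have lt_w (j : 'I_N.+1) : j < size w by rewrite szw.
have w_ran (j : 'I_N.+1) : 0 < nth 0 w j <= N.+1.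
  have: nth 0 w j \in iota 1 N.+1 by rewrite -(perm_mem pw) mem_nth ?szw.
  by rewrite mem_iota; lia.
have val_f (j : 'I_N.+1) : val (inord (nth 0 w j).-1 : 'I_N.+1) = (nth 0 w j).-1.
  by rewrite /= inordK //; have := w_ran j; lia.
have f_inj : injective (fun j : 'I_N.+1 => inord (nth 0 w j).-1 : 'I_N.+1).
  move=> j k /(congr1 val); rewrite !val_f => eq_jk; apply/val_inj/eqP.
  rewrite -(nth_uniq 0 (lt_w j) (lt_w k) uw) /=; apply/eqP.
  by have := w_ran j; have := w_ran k; lia.
exists (perm f_inj); apply: (@eq_from_nth _ 0).
  by rewrite size_map size_enum_ord szw.
move=> j; rewrite size_map size_enum_ord => lt_j.
rewrite (nth_map (Ordinal lt_j)) ?size_enum_ord // permE val_f nth_enum_ord //.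
by have := w_ran (Ordinal lt_j) => /=; lia.
Qed.

Lemma size_oneline N (p : {perm 'I_N}) : size (oneline p) = N.
Proof. by rewrite size_map size_enum_ord. Qed.

Lemma size_signature w : size (signature w) = (size w).-1.
Proof. by rewrite size_map size_iota. Qed.

(** For i < n both i and i+1 occur in [u], so [w] does not affect their order. *)
Lemma take_signature_cat n u w : perm_eq u (iota 1 n) ->
  take n.-1 (signature (u ++ w)) = signature u.
Proof.
move=> pu; have szu : size u = n by rewrite (perm_size pu) size_iota.
rewrite /signature -map_take take_iota size_cat szu.
rewrite (minn_idPl _); last lia.
apply/eq_in_map => i; rewrite mem_iota => i_ran.
by rewrite !index_cat !(perm_mem pu) !mem_iota !ifT //; lia.
Qed.

(** * Reading words and neighbors along edges *)

Lemma perm_reading_word n lam (T : syt n lam) :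
  perm_eq (reading_word T) (iota 1 n).
Proof.
case/and4P: (rowsP T) => _ pT _ _; apply: perm_trans pT.
by apply: perm_flatten; rewrite perm_rev.
Qed.

(** Edges are unordered, so the definition of [syt_graph] gives the relation from one end only;
    [dual_moveK] gives it from the other. *)
Lemma reading_word_syt_edge n lam i (T U : syt n lam) :
  [set T; U] \in edges (syt_graph n lam) i ->
  reading_word U = dual_move i (reading_word T).
Proof.
rewrite /=; case: ifP => [i_ran|_]; last by rewrite inE.
rewrite inE => /existsP[A /existsP[B /and3P[neqBA /eqP eqB /eqP eqTU]]].
have sub_A : {subset [:: i.-1; i; i.+1] <= reading_word A}.
  move=> x; rewrite (perm_mem (perm_reading_word A)) mem_iota !inE; lia.
have neqTU : T != U.
  have := congr1 (fun e : {set _} => #|e|) eqTU.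
  by rewrite !cards2 (eq_sym A) neqBA; case: (T == U).
have /set2P[TA|TB] : T \in [set A; B] by rewrite -eqTU set21.
  have /set2P[UA|-> //] : U \in [set A; B] by rewrite -eqTU set22.
    by rewrite TA UA eqxx in neqTU.
  by rewrite TA eqB.
have /set2P[->|UB] : U \in [set A; B] by rewrite -eqTU set22.
  by rewrite TB eqB dual_moveK //; lia.
by rewrite TB UB eqxx in neqTU.
Qed.

(** The matching covers every vertex that admits a neighbor, so [pick] succeeds and the default in
    [neighbor] does not arise. *)
Lemma neighbor_edge n N (V : finType) (G : scgraph n N V) i v :
    axiom1 G -> 1 < i < n -> admits_neighbor G i v ->
  [set v; neighbor G i v] \in edges G i.
Proof.
move=> G1 i_ran v_adm; rewrite /neighbor; case: pickP => // no_u.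
have /and3P[/eqP covE _ _] := G1 i i_ran.
have: v \in cover (edges G i) by rewrite covE inE.
case/bigcupP=> e Ee ve; have /cards2P[x [y [_ def_e]]] := introT eqP (edges_pair Ee).
rewrite {}def_e in Ee ve; case/set2P: ve Ee => def_v Ee.
  by have := no_u y; rewrite def_v Ee.
by have := no_u x; rewrite def_v setUC Ee.
Qed.

(** * Transport of a graph along a bijection, with possibly longer signatures *)

Section Transport.
Variables (n N : nat) (V W : finType) (G : scgraph n n V).
Variables (g : V -> W) (s : W -> seq bool) (le_nN : n <= N).
Hypotheses (g_inj : injective g) (size_s : forall w, size (s w) = N.-1).

Let tr_edges i := [set g @: (e : {set V}) | e in edges G i].

Fact tr_edges_range i e : e \in tr_edges i -> 1 < i < n.
Proof. by case/imsetP=> e' /edges_range. Qed.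

Fact tr_edges_pair i e : e \in tr_edges i -> #|e| = 2.
Proof. by case/imsetP=> e' /edges_pair <- ->; rewrite card_imset. Qed.

(** Only the edges are images under [g]. The signatures [s] are prescribed; [sig_s] asks that they
    extend those of [G]. *)
Definition transport : scgraph n N W :=
  SCGraph le_nN size_s tr_edges_range tr_edges_pair.

Hypothesis sig_s : forall v, take n.-1 (s (g v)) = sig G v.

Lemma admits_neighbor_transport i v : 1 < i < n ->
  admits_neighbor transport i (g v) = admits_neighbor G i v.
Proof.
move=> i_ran; rewrite /admits_neighbor /coord /= -sig_s.
(* Since i < n, the coordinates i-1 and i survive truncation. *)
by rewrite !nth_take //; lia.
Qed.

Variables (h : W -> V) (gK : cancel g h) (hK : cancel h g).

Lemma axiom1_transport : axiom1 G -> axiom1 transport.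
Proof.
move=> G1 i i_ran.
have -> : [set w | admits_neighbor transport i w] =
    g @: [set v | admits_neighbor G i v].
  apply/setP=> w; rewrite -[w]hK mem_imset // !inE.
  exact: admits_neighbor_transport.
by rewrite imset_partition //; apply: G1.
Qed.

Lemma isomorphic_transport :
  isomorphic G (restriction transport (leqnn n) le_nN).
Proof.
exists g, h; split=> //; split=> [v|i e] /=.
- exact: sig_s.
- by move=> Ee; have /andP[_ ->] := edges_range Ee; apply: imset_f.
- by rewrite -[in RHS](hK v) sig_s.
- case: ifP => [_|]; last by rewrite inE.
  case/imsetP=> e' Ee' ->; rewrite -imset_comp (eq_imset _ gK).
  by rewrite imset_id.
Qed.

End Transport.

(** * The graph of permutations attached to [phi] *)

Theorem theorem3p14 (n : nat) (lam : seq nat) (V : finType)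
    (G : scgraph n n V) (phi : V -> syt n lam) :
  is_partition_of n lam ->
  0 < #|V| ->
  axiom1 G ->
  scg_morphism G (syt_graph n lam) phi ->
  exists (N : nat) (le_nN : n <= N) (V' : {set {perm 'I_N}})
         (H : scgraph n N {w : {perm 'I_N} | w \in V'}),
    [/\ isomorphic G (restriction H (leqnn n) le_nN),
        axiom1 H,
        forall v', sig H v' = signature (oneline (val v')) &
        forall i v', 1 < i < n -> admits_neighbor H i v' ->
          knuth_equiv (oneline (val (neighbor H i v')))
                      (dual_move i (oneline (val v')))].
Proof.
move=> _ _ G1 [sig_phi edge_phi].
(* Ranks of vertices are below [K], as [tail_word] requires; the suffix adds K+1 letters to the n
   letters of the tableau. *)
pose K := #|V|; pose N := (n + K).+1.
have le_nN : n <= N by rewrite /N; lia.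
pose word v := reading_word (phi v) ++ tail_word n K (enum_rank v).
have pr v : perm_eq (reading_word (phi v)) (iota 1 n) by apply: perm_reading_word.
have szr v : size (reading_word (phi v)) = n by rewrite (perm_size (pr v)) size_iota.
have word_perm v : perm_eq (word v) (iota 1 N).
  by rewrite /N -addnS iotaD; apply: perm_cat (pr v) (tail_word_perm _ _ _).
have word_idx v : index n.+1 (word v) = n + (enum_rank v).+1.
  rewrite index_cat (perm_mem (pr v)) mem_iota ltnn andbF szr.
  by rewrite index_tail_word.
(* The default 1 is never taken, as [oneline_surj] applies to [word v]. *)
pose f v : {perm 'I_N} := odflt 1%g [pick p | oneline p == word v].
have fE v : oneline (f v) = word v.
  rewrite /f; case: pickP => [p /eqP // | no_p].
  by have [p def_p] := oneline_surj (word_perm v); have := no_p p; rewrite def_p eqxx.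
have f_inj : injective f.
  (* Equal permutations have n+1 at the same position, hence equal ranks. *)
  move=> u v eq_f; apply/enum_rank_inj/val_inj/eqP.
  by rewrite /= -eqSS -(eqn_add2l n) -!word_idx -!fE eq_f.
pose V' := [set f v | v in V].
have fV' v : f v \in V' by apply: imset_f.
pose g v : {w : {perm 'I_N} | w \in V'} := exist _ (f v) (fV' v).
have g_inj : injective g by move=> u v [/f_inj].
have g_surj w : exists v, g v == w.
  by have /imsetP[v _ def_w] := valP w; exists v; apply/eqP/val_inj.
pose h w := xchoose (g_surj w).
have hK : cancel h g by move=> w; apply/eqP/(xchooseP (g_surj w)).
have gK : cancel g h by move=> v; apply: g_inj; rewrite hK.
pose s (w : {w : {perm 'I_N} | w \in V'}) := signature (oneline (val w)).
have size_s w : size (s w) = N.-1 by rewrite size_signature size_oneline.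
have sig_s v : take n.-1 (s (g v)) = sig G v.
  by rewrite /s /= fE take_signature_cat // -sig_phi.
pose H := transport G le_nN g_inj size_s.
have H1 : axiom1 H by apply: axiom1_transport.
exists N, le_nN, V', H; split=> //; first exact: isomorphic_transport.
move=> i w i_ran w_adm; have := neighbor_edge H1 i_ran w_adm.
(* With w and its neighbor written as [g v] and [g u], injectivity of [g] on sets pulls their edge
   back to {v, u} in [G]. *)
rewrite -[w]hK -[neighbor _ _ _]hK; move: (h w) (h (neighbor _ _ _)) => v u.
rewrite -(imset_set1 g u) -imsetU1 [_ \in _](mem_imset _ _ (imset_inj g_inj)).
move=> /edge_phi; rewrite imsetU1 imset_set1 => /reading_word_syt_edge def_u.
rewrite /= !fE /word dual_move_cat => [|x x_i]; last first.
  rewrite (perm_mem (pr v)) (perm_mem (tail_word_perm _ _ _)) !mem_iota.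
  by move: x_i; rewrite !inE; lia.
(* Both words now consist of the reading word of [phi u] and a suffix. *)
rewrite -def_u; apply: knuth_equiv_tail_word => //; apply/allP=> x.
by rewrite (perm_mem (pr u)) mem_iota /=; lia.
Qed.
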